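(* Suppose $f\in\mathcal A_c$ with primitive $F\in\mathcal B_c$ such that the restriction $F|_I\in C^1(I)$ for some open interval $I\subset\mathbb R$ (so that on $I$, $f$ is the continuous function $F'(x)$, denoted $f(x)$). Define $u:\mathbb R\times[0,\infty)\to\mathbb R$ by $u(x,t)=f\ast\Theta_t(x)$ for $(x,t)\in\mathbb R\times(0,\infty)$, $u(x,0)=f(x)$ for $x\in I$, and $u(x,0)=0$ for $x\in\mathbb R\setminus I$. Then $u$ is continuous on $[\mathbb R\times(0,\infty)]\cup[I\times\{0\}]$.
   Context: Let $\mathcal B_c$ be the set of continuous $F:\mathbb R\to\mathbb R$ such that $\lim_{x\to\pm\infty}F(x)$ exist as real numbers and $\lim_{x\to-\infty}F(x)=0$. Let $\mathcal A_c$ be the set of distributions $f$ on $\mathbb R$ with $f=F'$ (distributional derivative) for some (unique) $F\in\mathcal B_c$, the primitive of $f$. The integral is $\int_a^bf=F(b)-F(a)$ for $a,b\in[-\infty,\infty]$. For $f\in\mathcal A_c$ and $h$ of bounded variation, $\int_{-\infty}^\infty fh:=F(\infty)h(\infty)-\int_{-\infty}^\infty F\,dh$ (Henstock–Stieltjes), and $f\ast h(x)=\int_{-\infty}^\infty f(\xi)h(x-\xi)\,d\xi$ in this sense. The heat kernel is $\Theta_t(x)=(4\pi t)^{-1/2}e^{-x^2/(4t)}$, $t>0$. *)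

(* Defs.v *)
From HB Require Import structures.
From mathcomp Require Import all_boot all_order all_algebra.
From mathcomp Require Import all_classical all_reals all_analysis.
Set Implicit Arguments. Unset Strict Implicit. Unset Printing Implicit Defensive.
Import Order.TTheory GRing.Theory Num.Theory.
Import numFieldNormedType.Exports.
Local Open Scope classical_set_scope.
Local Open Scope ring_scope.

Definition heat_kernel (R : realType) (t x : R) : R :=
  (Num.sqrt (4 * pi * t))^-1 * expR (- (x ^+ 2) / (4 * t)).

Definition in_Bc (R : realType) (F : R -> R) : Prop :=
  continuous F /\ (exists l : R, F @ +oo --> l) /\ F @ -oo --> (0 : R).

(* For f = F' in A_c and h smooth with h' integrable:
   int f h := F(oo) h(oo) - int F dh,  where the Stieltjes integral
   int F dh is the Lebesgue integral of F * h'. *)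
Definition Ac_pairing (R : realType) (F h : R -> R) : R :=
  lim (F @ +oo) * lim (h @ +oo)
  - Rintegral lebesgue_measure setT (fun xi : R => F xi * derive1 h xi).

Definition Ac_conv_heat (R : realType) (F : R -> R) (t x : R) : R :=
  Ac_pairing F (fun xi => heat_kernel t (x - xi)).

(* The function u of the statement (u(x,t) for t < 0 is irrelevant; set to 0). *)
Definition u_heat (R : realType) (F : R -> R) (I : set R) (p : R * R) : R :=
  if 0 < p.2 then Ac_conv_heat F p.2 p.1
  else if (p.2 == 0) && `[< I p.1 >] then derive1 F p.1 else 0.

(* Main.v *)
(* With s = 2 sqrt t, the substitution xi = x + s z and the vanishing first
   moment of exp (- z^2) turn the convolution into
     u(x,t) = 2 / sqrt pi * int (F (x + s z) - F x) / s * z exp (- z^2) dz.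
   Since int z^2 exp (- z^2) dz = sqrt pi / 2, the formula persists at t = 0
   once the quotient is read as F'(x) z.  The quotient is continuous in (x,t)
   for fixed z and, near any point of the domain, at most C (1 + |z|) because F
   is bounded, and Lipschitz near the points of I; dominated convergence
   concludes. *)
Require Import Defs.
From HB Require Import structures.
From mathcomp Require Import all_boot all_order all_algebra.
From mathcomp Require Import all_classical all_reals all_analysis.
From mathcomp Require Import measurable_realfun ring lra.
Set Implicit Arguments. Unset Strict Implicit. Unset Printing Implicit Defensive.
Import Order.TTheory GRing.Theory Num.Theory.
Import numFieldNormedType.Exports.
Local Open Scope classical_set_scope.
Local Open Scope ring_scope.

(** * Integrability and the first two moments of exp (- z^2) *)

Section gauss_moments.
Context {R : realType}.
Notation mu := (@lebesgue_measure R).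
Implicit Type z : R.

Lemma is_derive_gauss_fun z :
  is_derive z 1 (@gauss_fun R) (- (2 * z) * gauss_fun z).
Proof.
by rewrite /gauss_fun; apply: is_derive_eq; rewrite /GRing.scale/=; ring.
Qed.

Lemma continuous_sqr_gauss_fun : continuous (fun z => z ^+ 2 * gauss_fun z).
Proof.
move=> z; apply: cvgM; first exact: sqr_continuous.
exact: continuous_gauss_fun.
Qed.

Lemma continuous_id_gauss_fun : continuous (fun z => z * gauss_fun z).
Proof.
move=> z; apply: cvgM; [exact: cvg_id|exact: continuous_gauss_fun].
Qed.

Lemma continuous_le_integrable (f g : R -> R) : continuous f ->
  (forall z, `|f z| <= g z) -> mu.-integrable setT (EFin \o g) ->
  mu.-integrable setT (EFin \o f).
Proof.
move=> cf fg; apply: le_integrable => //.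
  by apply/measurable_EFinP; exact: continuous_measurable_fun.
move=> z _; rewrite /comp !abse_EFin lee_fin.
exact: le_trans (fg z) (ler_norm _).
Qed.

(** Comparison with a normal density: 1 + z^2 / 2 <= exp (z^2 / 2) gives z^2 exp (- z^2) <= 2 exp (-
    z^2 / 2), and the right-hand side is a multiple of [normal_pdf 0 1]. *)
Lemma integrable_sqr_gauss_fun :
  mu.-integrable setT (EFin \o (fun z => z ^+ 2 * gauss_fun z)).
Proof.
have n1 : (1 : R) != 0 by exact: oner_neq0.
apply: (@continuous_le_integrable _
    (fun z => 2 * (normal_peak 1)^-1 * normal_pdf 0 1 z)).
- exact: continuous_sqr_gauss_fun.
- move=> z; rewrite normal_pdfE// /normal_fun subr0 /=.
  rewrite mulrA divfK ?gt_eqF ?normal_peak_gt0//.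
  have /ger0_norm -> : 0 <= z ^+ 2 * gauss_fun z.
    by apply: mulr_ge0; [exact: sqr_ge0|exact: gauss_fun_ge0].
  set h := - z ^+ 2 / (1 ^+ 2 *+ 2).
  have hE : h = - (z ^+ 2 / 2) by rewrite /h expr1n mulNr.
  have -> : gauss_fun z = expR h * expR h.
    by rewrite -expRD /gauss_fun; congr expR; rewrite hE; field.
  rewrite mulrA ler_wpM2r ?expR_ge0// -ler_pdivlMr ?expR_gt0// -expRN.
  rewrite hE opprK; apply: le_trans (_ : 2 * (1 + z ^+ 2 / 2) <= _); first by lra.
  by rewrite ler_pM2l// expR_ge1Dx.
- have := integrableZl measurableT (2 * (normal_peak 1)^-1)
    (@integrable_normal_pdf R 0 1).
  by apply: eq_integrable => // z _; rewrite /= EFinM.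
Qed.

(** Up to a constant, this is the dominating function of the final passage to the limit. It also
    controls |z| exp (- z^2), since |z| <= 1 + z^2. *)
Lemma integrable_gauss_majorant :
  mu.-integrable setT (EFin \o (fun z => (1 + z ^+ 2) * gauss_fun z)).
Proof.
have := integrableD measurableT integrableT_gauss integrable_sqr_gauss_fun.
by apply: eq_integrable => // z _; rewrite /= mulrDl mul1r.
Qed.

Lemma integrable_id_gauss_fun :
  mu.-integrable setT (EFin \o (fun z => z * gauss_fun z)).
Proof.
apply: continuous_le_integrable integrable_gauss_majorant.
  exact: continuous_id_gauss_fun.
move=> z; rewrite normrM (ger0_norm (gauss_fun_ge0 z)).
by rewrite ler_wpM2r ?gauss_fun_ge0// ler_norml; nra.
Qed.

(** The integrand is odd and Lebesgue measure is invariant under reflection, so the integral equals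
    its own opposite. *)
Lemma Rintegral_id_gauss_fun : \int[mu]_z (z * gauss_fun z) = 0.
Proof.
set G := fun z => z * gauss_fun z.
have GN : G \o -%R = - G.
  by apply/funext => z; rewrite /G/= fctE /gauss_fun sqrrN mulNr.
have mG : measurable_fun setT (EFin \o G).
  apply/measurable_EFinP.
  exact: continuous_measurable_fun continuous_id_gauss_fun.
have iGN : mu.-integrable setT (EFin \o (G \o -%R)).
  by rewrite GN; exact: (integrableN integrable_id_gauss_fun).
have : \int[mu]_z G z = - \int[mu]_z G z.
  rewrite -[in RHS]mulN1r -RintegralZl//; last exact: integrable_id_gauss_fun.
  rewrite /Rintegral; congr fine.
  have mN : measurable_fun setT (-%R : measurableTypeR R -> measurableTypeR R).
    exact: oppr_measurable.
  have := integral_pushforward mN mG iGN measurableT.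
  rewrite preimage_setT => h.
  rewrite -[RHS](_ : \int[mu]_z ((EFin \o G) \o -%R) z = _)%E; last first.
    by apply: eq_integral => z _ /=; rewrite -[G (- z)]/((G \o -%R) z) GN mulN1r.
  rewrite -h; apply: eq_measure_integral => A mA _.
  exact/esym/lebesgue_measureN.
by move=> /eqP; rewrite -subr_eq0 opprK -mulr2n mulrn_eq0/= => /eqP.
Qed.

(** Evenness reduces the integral to the half-line. There, integration by parts on [0, n + 1] leaves
    half of the known Gaussian integral and a boundary term that vanishes as n grows. *)
Lemma Rintegral_sqr_gauss_fun :
  \int[mu]_z (z ^+ 2 * gauss_fun z) = Num.sqrt pi / 2.
Proof.
set G := fun z => z ^+ 2 * gauss_fun z.
have cG : continuous G by exact: continuous_sqr_gauss_fun.
have G0 z : 0 <= G z.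
  by apply: mulr_ge0; [exact: sqr_ge0|exact: gauss_fun_ge0].
have itvE : [set z : R | 0 <= z] = `[0, +oo[%classic.
  by apply/seteqP; split => z/=; rewrite in_itv/= andbT.
have finite_half (f : R -> R) : mu.-integrable setT (EFin \o f) ->
    (\int[mu]_(z in `[0%R, +oo[) (f z)%:E)%E \is a fin_num.
  by move=> fi; apply: integrable_fin_num => //; apply: integrableS fi.
have parts n : \int[mu]_(z in `[0, n.+1%:R]) G z =
    - (n.+1%:R * gauss_fun n.+1%:R / 2) +
    2^-1 * \int[mu]_(z in `[0, n.+1%:R]) gauss_fun z.
  (* An antiderivative of z exp (- z^2); the remaining factor z is the one that gets
     differentiated. *)
  pose g z : R := - (gauss_fun z / 2).
  have dg z : is_derive z 1 g (z * gauss_fun z).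
    have := is_derive_gauss_fun z => ?.
    rewrite /g; apply: is_derive_eq.
    by rewrite /GRing.scale/=; field.
  have cg : continuous g.
    by move=> z; apply: cvgN; apply: cvgMl; exact: continuous_gauss_fun.
  transitivity (\int[mu]_(z in `[0, n.+1%:R]) (idfun z * (z * gauss_fun z))).
    by apply: eq_Rintegral => z _; rewrite /G /= mulrA.
  rewrite (@Rintegration_by_parts _ idfun g (cst 1)).
  - rewrite /= mul0r subr0 -mulrN -mulrA; congr +%R; first by rewrite /g; ring.
    rewrite -[RHS]opprK -mulNr -RintegralZl//.
      by congr (- _); apply: eq_Rintegral => z _ /=; rewrite /g; ring.
    by apply: integrableS integrableT_gauss.
  - by rewrite ltr0n.
  - exact/continuous_subspaceT/cst_continuous.
  - split => //; first by apply: cvg_at_right_filter; exact: cvg_id.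
    by apply: cvg_at_left_filter; exact: cvg_id.
  - by move=> z _; rewrite derive1E derive_id.
  - by apply/continuous_subspaceT; exact: continuous_id_gauss_fun.
  - split.
    + by move=> z _.
    + by apply: cvg_at_right_filter; exact: cg.
    + by apply: cvg_at_left_filter; exact: cg.
  - by move=> z _; rewrite derive1E derive_val.
have cvg_half (f : R -> R) : (forall z, 0 <= f z) -> continuous f ->
    mu.-integrable setT (EFin \o f) ->
    \int[mu]_(z in `[0, n.+1%:R]) f z @[n --> \oo] -->
    \int[mu]_(z in `[0, +oo[) f z.
  move=> f0 cf fi.
  have mf : measurable_fun setT f by exact: continuous_measurable_fun.
  have /= h := @ge0_cvgn_integral R mu f f0 mf.
  rewrite (@cvg_shiftS _ (fun n => \int[mu]_(z in `[0, n%:R]) f z)).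
  apply: fine_cvg; rewrite fineK//; exact: finite_half.
have half (f : R -> R) : (forall z, 0 <= f z) -> continuous f -> f =1 f \o -%R ->
    mu.-integrable setT (EFin \o f) ->
    \int[mu]_z f z = 2 * \int[mu]_(z in `[0, +oo[) f z.
  move=> f0 cf fN fi.
  by rewrite /Rintegral ge0_symfun_integralT// itvE fineM//; exact: finite_half.
rewrite half//; first last.
- exact: integrable_sqr_gauss_fun.
- by move=> z; rewrite /G/= /gauss_fun sqrrN.
(* From exp (x^2) >= 1 + x^2 follows x^2 exp (- x^2) <= 1, so with x = n + 1 the boundary term is at
   most 1 / x. *)
have cvg0 : n.+1%:R * gauss_fun n.+1%:R / 2 @[n --> \oo] --> (0 : R).
  apply: (@squeeze_cvgr _ _ _ _ (cst 0) (@harmonic R)).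
  - near=> n; apply/andP; split; first by rewrite !mulr_ge0 ?expR_ge0.
    rewrite /harmonic/= -[leRHS]mul1r; set x : R := n.+1%:R.
    have x0 : 0 < x by rewrite ltr0n.
    rewrite ler_pdivlMr//.
    have : gauss_fun x <= (1 + x ^+ 2)^-1.
      rewrite /gauss_fun expRN lef_pV2 ?posrE ?expR_gt0 ?expR_ge1Dx//.
      by rewrite ltr_pwDl ?sqr_ge0.
    have x2 : 0 < 1 + x ^+ 2 by rewrite ltr_pwDl ?sqr_ge0.
    rewrite -(ler_pM2l x2) mulfV ?gt_eqF//.
    by have := gauss_fun_ge0 x; nra.
  - exact: cvg_cst.
  - exact: cvg_harmonic.
have lim_parts : \int[mu]_(z in `[0, n.+1%:R]) G z @[n --> \oo] -->
    - 0 + 2^-1 * \int[mu]_(z in `[0, +oo[) gauss_fun z.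
  under eq_fun do rewrite parts.
  apply: cvgD; first exact: cvgN.
  apply: cvgMr; apply: cvg_half.
  - exact: gauss_fun_ge0.
  - exact: continuous_gauss_fun.
  - exact: integrableT_gauss.
have := cvg_half _ G0 cG integrable_sqr_gauss_fun.
move=> /(cvg_unique _)/(_ lim_parts) ->//.
(* The half-line Gaussian integral is sqrt pi / 2; the factor 2 from evenness cancels the 1/2 from
   integration by parts. *)
by rewrite oppr0 add0r {1}/Rintegral integral0y_gauss/=; field.
Unshelve. all: by end_near. Qed.

End gauss_moments.

(** * Affine substitution in integrals over the real line *)

Section affine_change_of_variable.
Context {R : realType}.
Notation mu := (@lebesgue_measure R).
Implicit Types (G : R -> R) (a s z : R).

Lemma is_derive_affine a s z : is_derive z 1 (fun y => a + s * y) s.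
Proof. by apply: is_derive_eq; rewrite /GRing.scale/=; ring. Qed.

Lemma continuous_affine a s : continuous (fun y => a + s * y).
Proof.
by move=> z; apply: cvgD; [exact: cvg_cst|apply: cvgMr; exact: cvg_id].
Qed.

Lemma ge0_integral_affine G a s : 0 < s -> continuous G ->
  (forall z, 0 <= G z) ->
  (\int[mu]_z (G z)%:E = \int[mu]_z (G (a + s * z) * s)%:E)%E.
Proof.
move=> s0 cG G0; set phi := fun z => a + s * z.
have dphi : phi^`()%classic = cst s.
  apply/funext => z; rewrite derive1E.
  exact: (@derive_val _ _ _ _ _ _ _ (is_derive_affine a s z)).
rewrite (@increasing_ge0_integration_by_substitutionT _ phi)//.
- by rewrite dphi.
- by move=> x y xy; rewrite ltrD2l ltr_pM2l.
- by rewrite dphi => z; exact: cvg_cst.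
- by rewrite dphi; exact: is_cvg_cst.
- by rewrite dphi; exact: is_cvg_cst.
- apply/cvgrNyPle => A; near=> z.
  by rewrite /phi -lerBrDl mulrC -ler_pdivlMr//.
- apply/cvgryPge => A; near=> z.
  by rewrite /phi -lerBlDl mulrC -ler_pdivrMr//.
Unshelve. all: by end_near. Qed.

(** The nonnegative substitution, applied to |G|, shows that the integral of the absolute value is
    unchanged. *)
Lemma integrable_affine G a s : 0 < s -> continuous G ->
  mu.-integrable setT (EFin \o G) ->
  mu.-integrable setT (EFin \o (fun z => G (a + s * z) * s)).
Proof.
move=> s0 cG /integrableP[_ Goo]; apply/integrableP; split.
  apply/measurable_EFinP; apply: continuous_measurable_fun => z.
  apply: cvgMl; apply: (@continuous_comp _ _ _ (fun y => a + s * y) G).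
    exact: continuous_affine.
  exact: cG.
apply: le_lt_trans Goo; rewrite le_eqVlt; apply/orP; left; apply/eqP.
have := @ge0_integral_affine (fun z => `|G z|) a s s0.
have cnG : continuous (fun z => `|G z|).
  by move=> z; apply: cvg_norm; exact: cG.
move=> /(_ cnG (fun=> normr_ge0 _)) h; rewrite [RHS]h.
by apply: eq_integral => z _ /=; rewrite normrM (gtr0_norm s0).
Qed.

(** The nonnegative case extends by linearity through G = (G + |G|) - |G|, where both terms are
    nonnegative, continuous and integrable. *)
Lemma Rintegral_affine G a s : 0 < s -> continuous G ->
  mu.-integrable setT (EFin \o G) ->
  \int[mu]_z G z = \int[mu]_z (G (a + s * z) * s).
Proof.
move=> s0 cG iG.
pose N z := `|G z|; pose P z := G z + N z.
have cN : continuous N by move=> z; apply: cvg_norm; exact: cG.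
have cP : continuous P by move=> z; apply: cvgD; [exact: cG|exact: cN].
have iN : mu.-integrable setT (EFin \o N) by exact: integrable_norm.
have iP : mu.-integrable setT (EFin \o P) by exact: (integrableD measurableT iG iN).
have N0 z : 0 <= N z by exact: normr_ge0.
have P0 z : 0 <= P z by rewrite /P /N -lerBlDl sub0r -normrN; exact: ler_norm.
transitivity (\int[mu]_z (P z - N z)).
  by apply: eq_Rintegral => z _; rewrite /P addrK.
transitivity (\int[mu]_z (P (a + s * z) * s - N (a + s * z) * s)); last first.
  by apply: eq_Rintegral => z _; rewrite -mulrBl /P addrK.
rewrite !RintegralB//; [|exact: integrable_affine..].
rewrite /Rintegral (ge0_integral_affine a s0 cP P0).
by rewrite (ge0_integral_affine a s0 cN N0).
Qed.

End affine_change_of_variable.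

(** * The convolution with the heat kernel as a Gaussian integral of difference quotients *)

Section heat_kernel.
Context {R : realType}.
Notation mu := (@lebesgue_measure R).
Implicit Types (F : R -> R) (x t : R).

(** With s = 2 sqrt t one has s^2 = 4 t, so the kernel is the Gaussian at scale s. The square lets x
    - y become y - x, which is the variable of the substitution. *)
Lemma heat_kernel_subE t x y : 0 < t ->
  heat_kernel t (x - y) =
  (Num.sqrt pi * (2 * Num.sqrt t))^-1 * gauss_fun ((y - x) / (2 * Num.sqrt t)).
Proof.
move=> t0; have t0' : 0 <= t := ltW t0.
have s4 : Num.sqrt (4 : R) = 2.
  by rewrite (_ : 4 = 2 ^+ 2) ?sqrtr_sqr ?ger0_norm//; ring.
rewrite /heat_kernel -mulrA mulrCA !sqrtrM ?pi_ge0// ?mulr_ge0// s4.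
rewrite -mulrCA /gauss_fun; congr (_^-1 * expR _).
by rewrite exprMn exprVn exprMn sqr_sqrtr// mulNr (_ : 4 = 2 ^+ 2)//; ring.
Qed.

Lemma derive1_heat_kernel t x xi : 0 < t ->
  derive1 (fun y => heat_kernel t (x - y)) xi =
  - (2 / (Num.sqrt pi * (2 * Num.sqrt t) ^+ 2)) *
  ((xi - x) / (2 * Num.sqrt t) * gauss_fun ((xi - x) / (2 * Num.sqrt t))).
Proof.
move=> t0.
set s := 2 * Num.sqrt t.
have s0 : 0 < s by rewrite mulr_gt0// sqrtr_gt0.
have sp0 : 0 < Num.sqrt (pi : R) by rewrite sqrtr_gt0 pi_gt0.
have -> : (fun y => heat_kernel t (x - y)) =
    fun y => (Num.sqrt pi * s)^-1 * gauss_fun (- x / s + s^-1 * y).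
  apply/funext => y; rewrite heat_kernel_subE//.
  by congr (_ * gauss_fun _); rewrite -/s; ring.
have dg := is_derive_gauss_fun (- x / s + s^-1 * xi).
have da := is_derive_affine (- x / s) (s^-1) xi.
have dc := @is_derive1_comp R _ (fun y => - x / s + s^-1 * y) xi _ _ dg da.
have dk := is_deriveZ (Num.sqrt pi * s)^-1 dc.
rewrite derive1E (@derive_val _ _ _ _ _ _ _ dk).
rewrite /GRing.scale/=.
have -> : - x / s + s^-1 * xi = (xi - x) / s by ring.
by field; rewrite !gt_eqF.
Qed.

(** This makes the boundary term F(oo) h(oo) of [Ac_pairing] vanish. *)
Lemma cvg_heat_kernel t x : 0 < t ->
  heat_kernel t (x - xi) @[xi --> +oo] --> (0 : R).
Proof.
move=> t0; set s := 2 * Num.sqrt t.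
have s0 : 0 < s by rewrite mulr_gt0// sqrtr_gt0.
rewrite (_ : (fun y => heat_kernel t (x - y)) =
    fun y => (Num.sqrt pi * s)^-1 * gauss_fun ((y - x) / s)); last first.
  by apply/funext => y; rewrite heat_kernel_subE.
rewrite -[X in _ --> X](mulr0 (Num.sqrt pi * s)^-1).
apply: cvgMr; apply: (@cvg_comp _ _ _ (fun y => (y - x) / s) gauss_fun _ (+oo)).
  apply/cvgryPge => A; near=> z.
  by rewrite ler_pdivlMr// lerBrDr.
exact: cvg_gauss_fun.
Unshelve. all: by end_near. Qed.

(** The limits at both ends control the tails, and compactness controls the segment between them. *)
Lemma in_Bc_bounded F : in_Bc F -> exists M : R, forall x, `|F x| <= M.
Proof.
move=> [cF [[l Fy] FNy]].
have [A [Areal FA]] : \forall y \near +oo, `|F y| <= `|l| + 1.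
  by apply: (cvgr_norm_le _ Fy); rewrite ltrDl.
have [B [Breal FB]] : \forall y \near -oo, `|F y| <= 1.
  by apply: (cvgr_norm_le _ FNy); rewrite normr0.
have cpt := @segment_compact R (B - 1) (A + 1).
have /compact_bounded[C [_ hC]] := continuous_compact (continuous_subspaceT cF) cpt.
have {}hC y : B - 1 <= y <= A + 1 -> `|F y| <= C + 1.
  move=> yI; apply: (hC (C + 1)); first by rewrite ltrDl.
  by exists y => //=; rewrite in_itv.
exists (`|l| + 1 + `|C + 1|) => y.
have [yA|Ay] := ltP A y.
  by apply: le_trans (FA _ yA) _; rewrite lerDl.
have [yB|By] := ltP y B.
  by apply: le_trans (FB _ yB) _; rewrite -addrA addrCA lerDl addr_ge0.
apply: le_trans (hC y _) _.
  by rewrite (le_trans _ By) ?(le_trans Ay)// ?lerDl// gerBl.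
by apply: le_trans (ler_norm _) _; rewrite lerDr addr_ge0.
Qed.

Lemma Ac_conv_heatE F t x : in_Bc F -> 0 < t ->
  Ac_conv_heat F t x = 2 / Num.sqrt pi *
  \int[mu]_z ((F (x + 2 * Num.sqrt t * z) - F x) / (2 * Num.sqrt t) *
              (z * gauss_fun z)).
Proof.
move=> BF t0.
have [M FM] := in_Bc_bounded BF; have cF := BF.1.
set s := 2 * Num.sqrt t.
have s0 : 0 < s by rewrite mulr_gt0// sqrtr_gt0.
have sp0 : 0 < Num.sqrt (pi : R) by rewrite sqrtr_gt0 pi_gt0.
pose w (z : R) := z * gauss_fun z.
have cw : continuous w := continuous_id_gauss_fun.
have iw : mu.-integrable setT (EFin \o w) := integrable_id_gauss_fun.
pose H z := F (x + s * z) * w z.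
have cH : continuous H.
  move=> z; apply: cvgM; last exact: cw.
  apply: (@continuous_comp _ _ _ (fun y => x + s * y) F).
    exact: continuous_affine.
  exact: cF.
have iH : mu.-integrable setT (EFin \o H).
  apply: (@continuous_le_integrable _ _ (fun z => M * `|w z|)) => //.
    by move=> z; rewrite normrM ler_wpM2r.
  exact: (integrableZl measurableT M (integrable_norm iw)).
rewrite /Ac_conv_heat /Ac_pairing (cvg_lim _ (cvg_heat_kernel x t0))//.
rewrite mulr0 sub0r.
(* The substitution is applied backwards, with z = (xi - x) / s. The minus sign of the pairing
   cancels that of the derivative of the kernel. *)
transitivity (2 / Num.sqrt pi * (s^-1 * \int[mu]_z H z)).
  rewrite (@Rintegral_affine _ H (- x / s) s^-1)// ?invr_gt0//.
  pose k xi := H (- x / s + s^-1 * xi) * s^-1.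
  have ik : mu.-integrable setT (EFin \o k).
    by apply: integrable_affine; rewrite ?invr_gt0.
  rewrite mulrA -[RHS]opprK -mulNr -RintegralZl//; congr (- _).
  apply: eq_Rintegral => xi _; rewrite derive1_heat_kernel// -/s /k /H.
  have -> : - x / s + s^-1 * xi = (xi - x) / s by ring.
  have -> : x + s * ((xi - x) / s) = xi by field; rewrite gt_eqF.
  by rewrite /w; field; rewrite !gt_eqF.
congr (_ * _).
(* Since z exp (- z^2) has integral zero, the constant F x can be subtracted for free; this creates
   the difference quotient. *)
have -> : \int[mu]_z H z = \int[mu]_z (H z - F x * w z).
  rewrite RintegralB//; last exact: (integrableZl measurableT (F x) iw).
  by rewrite RintegralZl// Rintegral_id_gauss_fun mulr0 subr0.
rewrite -RintegralZl//; last first.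
  exact: (integrableB measurableT iH (integrableZl measurableT (F x) iw)).
by apply: eq_Rintegral => z _; rewrite /H -/(w z); ring.
Qed.

End heat_kernel.

(** * Dominated convergence along a neighbourhood filter restricted to a set *)

Section dominated_convergence_within.
Context {d} {Y : measurableType d} {R : realType} {T : pseudoMetricType R}.
Context (mu : {measure set Y -> \bar R}).

(* A sequence in [A] tending to [p] but violating the conclusion reduces this
   to the sequential theorem. *)
Lemma cvg_Rintegral_within (A : set T) (p : T) (f : T -> Y -> R) (l g : Y -> R) :
  (forall q, measurable_fun setT (f q)) -> measurable_fun setT l ->
  mu.-integrable setT (EFin \o g) ->
  (\forall q \near within A (nbhs p), forall y, `|f q y| <= g y) ->
  (forall y, f q y @[q --> within A (nbhs p)] --> l y) ->
  \int[mu]_y f q y @[q --> within A (nbhs p)] --> \int[mu]_y l y.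
Proof.
move=> mf ml ig fg fl; apply/cvgrPdist_lt => e e0.
apply: contrapT => nint.
(* Domination holds only near p, whereas the sequential theorem is applied with a bound at every
   index; the bound is therefore part of the choice of each q. *)
have exq n : exists q, [/\ ball p (n.+1%:R^-1) q, A q,
    (forall y, `|f q y| <= g y) &
    ~ `|\int[mu]_y l y - \int[mu]_y f q y| < e].
  apply: contrapT => /forallNP nq; apply: nint.
  have pn : \forall q \near within A (nbhs p), ball p (n.+1%:R^-1) q.
    by apply: cvg_within; apply: nbhsx_ballx; rewrite invr_gt0.
  have pA : \forall q \near within A (nbhs p), A q by exact: withinT.
  by near=> q; apply: contrapT => qe; apply: (nq q); split => //; near: q.
have [u uP] := choice exq.
have up : u n @[n --> \oo] --> within A (nbhs p).
  move=> B; rewrite /within/= => /nbhs_ballP[r /= r0 rB].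
  change (\forall n \near \oo, B (u n)).
  near=> n; have [un uA _ _] := uP n; apply: rB => //.
  apply: (le_ball _ un); apply/ltW; near: n.
  exact: near_infty_natSinv_lt (PosNum r0).
have mEl : measurable_fun setT (EFin \o l) by exact/measurable_EFinP.
have mEf n : measurable_fun setT (EFin \o f (u n)).
  by apply/measurable_EFinP; exact: mf.
have := @dominated_convergence _ _ _ mu setT measurableT
  (fun n => EFin \o f (u n)) (EFin \o l) (EFin \o g) mEf mEl _ ig _.
case.
- apply: aeW => y _; apply: cvg_EFin; first by near=> n.
  exact: cvg_comp up (fl y).
- apply: aeW => y n _ /=; rewrite lee_fin.
  by have [_ _ + _] := uP n; apply.
move=> il _ cv.
have {cv} : \int[mu]_y f (u n) y @[n --> \oo] --> \int[mu]_y l y.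
  apply: fine_cvg; rewrite fineK//; exact: integrable_fin_num.
(* Any index past the threshold contradicts the choice of [u]; the threshold N itself is taken. *)
move=> /cvgrPdist_lt/(_ _ e0)[N _ /(_ N (leqnn N))] /= h.
by have [_ _ _] := uP N; apply.
Unshelve. all: by end_near. Qed.

End dominated_convergence_within.

(** * Limits and Gaussian domination of the difference quotient *)

Section difference_quotient.
Context {R : realType}.
Notation mu := (@lebesgue_measure R).
Implicit Types (F : R -> R) (I : set R) (A : set (R * R)) (p q : R * R).

(** The mean value theorem is used on a ball inside I where F' stays within e of F'(x0). Both
    endpoints are free because the base point will move along with the increment. *)
Lemma strict_derivative F I (x0 e : R) : open I -> I x0 ->
  (forall x, I x -> derivable F x 1) -> {for x0, continuous (derive1 F)} ->
  0 < e ->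
  exists2 d, 0 < d & forall a b, `|a - x0| < d -> `|b - x0| < d ->
    `|F b - F a - derive1 F x0 * (b - a)| <= e * `|b - a|.
Proof.
move=> oI Ix0 dF cF' e0.
have /nbhs_ballP[d /= d0 dI] : \forall y \near x0,
    I y /\ `|derive1 F x0 - derive1 F y| <= e.
  near=> y; split; first by near: y; exact: open_nbhs_nbhs.
  by near: y; exact: (cvgr_dist_le _ _ cF' _ e0).
(* Exchanging a and b only changes signs inside the absolute values. *)
exists d => // a b; wlog ab : a b / a <= b.
  move=> h ad bd; have [ab|/ltW ba] := leP a b; first exact: h.
  have {h} := h _ _ ba bd ad; rewrite -normrN (distrC a b).
  by congr (`|_| <= _); ring.
move=> ad bd.
have abd y : y \in `[a, b] -> ball x0 d y.
  rewrite in_itv/= => /andP[ay yb]; rewrite /ball/= distrC.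
  move: ad bd; rewrite !ltr_norml => /andP[ad1 ad2] /andP[bd1 bd2].
  by apply/andP; split; lra.
have [||c /abd/dI[_ ce] ->] := @MVT_segment _ F (derive1 F) a b ab.
- move=> y /subset_itv_oo_cc/abd/dI[Iy _].
  by rewrite derive1E; apply/derivableP; exact: dF.
- apply: derivable_within_continuous => y /abd/dI[Iy _]; exact: dF.
by rewrite -mulrBl normrM ler_wpM2r// distrC.
Unshelve. all: by end_near. Qed.

(* The integrand of [Ac_conv_heat] after the substitution
   [xi = x + 2 sqrt t * z], extended by its limit at [t = 0]. *)
Definition heat_quotient F (p : R * R) (z : R) : R :=
  if 0 < p.2 then (F (p.1 + 2 * Num.sqrt p.2 * z) - F p.1) / (2 * Num.sqrt p.2)
  else derive1 F p.1 * z.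

Lemma continuous_heat_quotient F p : continuous F -> continuous (heat_quotient F p).
Proof.
move=> cF z; rewrite /heat_quotient; case: (0 < p.2).
  apply: cvgMl; apply: cvgB; last exact: cvg_cst.
  apply: (@continuous_comp _ _ _ (fun y => p.1 + 2 * Num.sqrt p.2 * y) F).
    exact: continuous_affine.
  exact: cF.
by apply: cvgMr; exact: cvg_id.
Qed.

Lemma u_heatE F I p : in_Bc F -> 0 < p.2 \/ (I p.1 /\ p.2 = 0) ->
  u_heat F I p = 2 / Num.sqrt pi *
    \int[mu]_z (heat_quotient F p z * (z * gauss_fun z)).
Proof.
move=> BF; rewrite /u_heat /heat_quotient; case: ifPn => [p20 _|p20 [//|[Ip p2]]].
  exact: Ac_conv_heatE.
rewrite p2 eqxx (asboolT Ip)/=.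
(* At t = 0, F'(x) is multiplied and divided by the second moment sqrt pi / 2, which brings back the
   integral. *)
transitivity (2 / Num.sqrt pi * (derive1 F p.1 * (Num.sqrt pi / 2))).
  by field; rewrite gt_eqF// sqrtr_gt0 pi_gt0.
rewrite -Rintegral_sqr_gauss_fun -RintegralZl//; last first.
  exact: integrable_sqr_gauss_fun.
by congr (_ * _); apply: eq_Rintegral => z _; ring.
Qed.

Lemma cvg_dbl_sqrt p : 2 * Num.sqrt q.2 @[q --> p] --> 2 * Num.sqrt p.2.
Proof.
apply: cvgMr; apply: (@cvg_comp _ _ _ snd Num.sqrt _ (nbhs p.2)).
  exact: cvg_snd.
exact: sqrt_continuous.
Qed.

(** Near a point of positive time only the first branch of [heat_quotient] occurs, and its
    denominator stays away from zero. *)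
Lemma heat_quotient_cvg_gt0 F A p z : continuous F -> 0 < p.2 ->
  heat_quotient F q z @[q --> within A (nbhs p)] --> heat_quotient F p z.
Proof.
move=> cF p0; apply: cvg_within_filter.
have csnd : q.2 @[q --> p] --> p.2 by exact: cvg_snd.
have near0 : \forall q \near p, 0 < q.2 by exact: (cvgr_gt _ csnd _ p0).
rewrite {2}/heat_quotient p0.
have csqrt := @cvg_dbl_sqrt p.
have cfst : q.1 @[q --> p] --> p.1 by exact: cvg_fst.
apply: cvg_trans (_ : (F (q.1 + 2 * Num.sqrt q.2 * z) - F q.1) /
    (2 * Num.sqrt q.2) @[q --> p] --> _).
  apply: near_eq_cvg; near=> q; rewrite /heat_quotient ifT//.
  by near: q.
apply: cvgM; last first.
  by apply: cvgV => //; rewrite gt_eqF// mulr_gt0// sqrtr_gt0.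
apply: cvgB.
  apply: (@cvg_comp _ _ _ (fun q => q.1 + 2 * Num.sqrt q.2 * z) F); last exact: cF.
  by apply: cvgD => //; exact: cvgMl.
by apply: (@cvg_comp _ _ _ fst F _ (nbhs p.1)) => //; exact: cF.
Unshelve. all: by end_near. Qed.

Lemma heat_quotient_bound_gt0 F A p M : (forall x, `|F x| <= M) ->
  0 < p.2 -> exists C, \forall q \near within A (nbhs p), forall z,
    `|heat_quotient F q z * (z * gauss_fun z)| <= C * ((1 + z ^+ 2) * gauss_fun z).
Proof.
move=> FM p0; have M0 : 0 <= M by exact: le_trans (FM 0).
(* The increment of F is at most 2 M, near p the factor 1 / s exceeds its value at p by at most 1,
   and |z| <= 1 + z^2. *)
exists (2 * M * ((2 * Num.sqrt p.2)^-1 + 1)); apply: cvg_within.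
have csnd : q.2 @[q --> p] --> p.2 by exact: cvg_snd.
have near0 : \forall q \near p, 0 < q.2 by exact: (cvgr_gt _ csnd _ p0).
have csqrt : (2 * Num.sqrt q.2)^-1 @[q --> p] --> (2 * Num.sqrt p.2)^-1.
  by apply: cvgV (@cvg_dbl_sqrt p); rewrite gt_eqF// mulr_gt0// sqrtr_gt0.
near=> q => z.
have q0 : 0 < q.2 by near: q.
have s0 : 0 <= (2 * Num.sqrt q.2)^-1 by rewrite invr_ge0 mulr_ge0.
have s1 : (2 * Num.sqrt q.2)^-1 <= (2 * Num.sqrt p.2)^-1 + 1.
  by near: q; apply: (cvgr_le _ csqrt); rewrite ltrDl.
rewrite /heat_quotient q0 !normrM (ger0_norm (gauss_fun_ge0 z)) (ger0_norm s0).
rewrite !mulrA ler_wpM2r ?gauss_fun_ge0//.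
apply: ler_pM => //.
  apply: ler_pM => //; apply: le_trans (ler_normB _ _) _.
  by rewrite [leRHS]mulr_natl mulr2n lerD.
by rewrite ler_norml; apply/andP; split; nra.
Unshelve. all: by end_near. Qed.

(** For q.2 > 0, [strict_derivative] applies with base point q.1 and increment s z. For q.2 <= 0 the
    value is F'(q.1) z and continuity of F' suffices, so a full neighbourhood of p is allowed. *)
Lemma heat_quotient_cvg_eq0 F I p z : open I -> I p.1 -> p.2 = 0 ->
  (forall x, I x -> derivable F x 1) -> {for p.1, continuous (derive1 F)} ->
  heat_quotient F q z @[q --> nbhs p] --> heat_quotient F p z.
Proof.
move=> oI Ip p2 dF cF'; rewrite {2}/heat_quotient p2 ltxx.
apply/cvgrPdist_le => e e0.
have z0 : 0 < 1 + `|z| by rewrite ltr_pwDl.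
(* Multiplied by |z|, this tolerance stays below e; the added 1 covers z = 0. *)
have ez0 : 0 < e / (1 + `|z|) by rewrite divr_gt0.
have [d d0 dP] := strict_derivative oI Ip dF cF' ez0.
have csqrt : 2 * Num.sqrt q.2 * z @[q --> p] --> 0.
  rewrite [X in _ --> X](_ : _ = 2 * Num.sqrt p.2 * z); last first.
    by rewrite p2 sqrtr0 mulr0 mul0r.
  by apply: cvgMl; exact: cvg_dbl_sqrt.
have cfst : q.1 @[q --> p] --> p.1 by exact: cvg_fst.
have cdF : derive1 F q.1 @[q --> p] --> derive1 F p.1.
  by apply: (@cvg_comp _ _ _ fst (derive1 F) _ (nbhs p.1)) => //; exact: cF'.
near=> q.
have eE : e / (1 + `|z|) * `|z| <= e.
  by rewrite mulrAC ler_pdivrMr// ler_pM2l// lerDr.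
(* Half of d goes to the shift of the base point and half to the increment, so that q.1 and q.1 + s
   z both lie within d of p.1. *)
have dq : `|q.1 - p.1| < d / 2.
  by rewrite distrC; near: q; apply: (cvgr_dist_lt _ _ cfst); rewrite divr_gt0.
have dz : `|2 * Num.sqrt q.2 * z| < d / 2.
  by near: q; apply: (cvgr0_norm_lt _ csqrt); rewrite divr_gt0.
rewrite /heat_quotient; case: ifPn => [q0|_]; last first.
  rewrite -mulrBl normrM; apply: le_trans eE; rewrite ler_wpM2r//.
  by near: q; exact: (cvgr_dist_le _ _ cdF).
set s := 2 * Num.sqrt q.2.
have s0 : 0 < s by rewrite mulr_gt0// sqrtr_gt0.
have := dP q.1 (q.1 + s * z).
rewrite (_ : q.1 + s * z - q.1 = s * z); last by ring.
move=> h; rewrite distrC; apply: le_trans eE.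
rewrite [X in `|X|](_ : _ =
    (F (q.1 + s * z) - F q.1 - derive1 F p.1 * (s * z)) / s); last first.
  by field; rewrite gt_eqF.
rewrite normrM normfV (gtr0_norm s0) ler_pdivrMr//.
rewrite (_ : _ * s = e / (1 + `|z|) * `|s * z|); last first.
  by rewrite normrM (gtr0_norm s0); ring.
apply: h; first by apply: lt_trans dq _; lra.
rewrite (_ : _ - _ = (q.1 - p.1) + s * z); last by ring.
by apply: le_lt_trans (ler_normD _ _) _; rewrite (splitr d) ltrD.
Unshelve. all: by end_near. Qed.

(** For q.2 > 0, increments are split at |s z| = d / 2: F is Lipschitz on the shorter ones and
    merely bounded on the longer ones. Every case gives a quotient of size at most C |z|. *)
Lemma heat_quotient_bound_eq0 F I p M : (forall x, `|F x| <= M) ->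
  open I -> I p.1 ->
  (forall x, I x -> derivable F x 1) -> {for p.1, continuous (derive1 F)} ->
  exists C, \forall q \near p, forall z,
    `|heat_quotient F q z * (z * gauss_fun z)| <= C * ((1 + z ^+ 2) * gauss_fun z).
Proof.
move=> FM oI Ip dF cF'; have M0 : 0 <= M by exact: le_trans (FM 0).
have [d d0 dP] := strict_derivative oI Ip dF cF' ltr01.
(* A Lipschitz constant of F near p.1, from the strict derivative with tolerance 1; it also bounds
   F'(q.1) for q near p. *)
pose K := `|derive1 F p.1| + 1; have K0 : 0 <= K by rewrite addr_ge0.
pose C := K + 2 * M * (d / 2)^-1.
have KC : K <= C by rewrite lerDl !mulr_ge0// invr_ge0 divr_ge0// ltW.
have C0 : 0 <= C by exact: le_trans KC.
exists C.
have cfst : q.1 @[q --> p] --> p.1 by exact: cvg_fst.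
have cdF : derive1 F q.1 @[q --> p] --> derive1 F p.1.
  by apply: (@cvg_comp _ _ _ fst (derive1 F) _ (nbhs p.1)) => //; exact: cF'.
near=> q => z.
suff Cz : `|heat_quotient F q z| <= C * `|z|.
  rewrite normrM normrM (ger0_norm (gauss_fun_ge0 z)).
  apply: le_trans (ler_wpM2r _ Cz) _; first by rewrite mulr_ge0 ?gauss_fun_ge0.
  rewrite -!mulrA ler_wpM2l// mulrA ler_wpM2r ?gauss_fun_ge0//.
  by rewrite -normrM ger0_norm -expr2 ?sqr_ge0// lerDr.
have dq : `|q.1 - p.1| < d / 2.
  by rewrite distrC; near: q; apply: (cvgr_dist_lt _ _ cfst); rewrite divr_gt0.
rewrite /heat_quotient; case: ifPn => [q0|_]; last first.
  rewrite normrM ler_wpM2r//; apply: le_trans KC.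
  by near: q; apply: (cvgr_norm_le _ cdF); rewrite ltrDl.
set s := 2 * Num.sqrt q.2.
have s0 : 0 < s by rewrite mulr_gt0// sqrtr_gt0.
rewrite normrM normfV (gtr0_norm s0) ler_pdivrMr//.
rewrite [leRHS](_ : _ = C * `|s * z|); last by rewrite normrM (gtr0_norm s0); ring.
have [sz|sz] := ltP `|s * z| (d / 2).
  apply: le_trans (_ : K * `|s * z| <= _); last by rewrite ler_wpM2r.
  have := dP q.1 (q.1 + s * z).
  rewrite (_ : q.1 + s * z - q.1 = s * z); last by ring.
  rewrite mul1r => h.
  rewrite mulrDl mul1r -normrM -lerBlDl.
  apply: le_trans (lerB_dist _ _) _; apply: h.
    by apply: lt_trans dq _; lra.
  rewrite (_ : _ - _ = (q.1 - p.1) + s * z); last by ring.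
  by apply: le_lt_trans (ler_normD _ _) _; rewrite (splitr d) ltrD.
(* Long increments: 2 M <= 2 M (d / 2)^-1 |s z| because |s z| >= d / 2, which accounts for the
   second summand of [C]. *)
apply: le_trans (ler_normB _ _) _.
apply: le_trans (_ : 2 * M <= _); first by rewrite [leRHS]mulr_natl mulr2n lerD.
apply: le_trans (_ : 2 * M * (d / 2)^-1 * `|s * z| <= _); last first.
  by rewrite ler_wpM2r// lerDr.
by rewrite -mulrA ler_peMr ?mulr_ge0// mulrC ler_pdivlMr ?mul1r// divr_gt0.
Unshelve. all: by end_near. Qed.

End difference_quotient.

(** * Continuity up to the part of the initial line over I *)

Theorem theorem3p5 (R : realType) (F : R -> R) (I : set R) :
  in_Bc F ->
  open I -> is_interval I ->
  (forall x, I x -> derivable F x 1) ->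
  (forall x, I x -> {for x, continuous (derive1 F)}) ->
  {within [set p : R * R | 0 < p.2] `|` [set p : R * R | I p.1 /\ p.2 = 0],
     continuous u_heat F I}.
Proof.
move=> BF oI _ dF cF'; set S := _ `|` _.
have cF := BF.1; have [M FM] := in_Bc_bounded BF.
apply/subspace_continuousP => p Sp.
rewrite /from_subspace u_heatE//.
pose J q := 2 / Num.sqrt pi *
  \int[lebesgue_measure]_z (heat_quotient F q z * (z * gauss_fun z)).
(* The integral formula is available at the points of S, which are all that the filter within S
   sees. *)
have uJ : {near within S (nbhs p), J =1 u_heat F I}.
  by near=> q; rewrite u_heatE//; near: q; exact: withinT.
apply: cvg_trans (near_eq_cvg uJ) _; rewrite /J.
apply: cvgMr.
have ch q : continuous (fun z => heat_quotient F q z * (z * gauss_fun z)).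
  move=> z; apply: cvgM; first exact: continuous_heat_quotient.
  exact: continuous_id_gauss_fun.
(* The constant depends on p: at positive time the bound M on F is enough, while on the initial line
   the C^1 regularity near p.1 enters as well. *)
have [C hC] : exists C, \forall q \near within S (nbhs p), forall z,
    `|heat_quotient F q z * (z * gauss_fun z)| <= C * ((1 + z ^+ 2) * gauss_fun z).
  case: Sp => [p0|[Ip p0]]; first exact: heat_quotient_bound_gt0 FM p0.
  have [C hC] := heat_quotient_bound_eq0 FM oI Ip dF (cF' _ Ip).
  by exists C; exact: cvg_within.
apply: (@cvg_Rintegral_within _ _ R _ lebesgue_measure S p
  (fun q z => heat_quotient F q z * (z * gauss_fun z)) _
  (fun z => C * ((1 + z ^+ 2) * gauss_fun z))) => //.
- by move=> q; exact: continuous_measurable_fun.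
- exact: continuous_measurable_fun.
- exact: (integrableZl measurableT C integrable_gauss_majorant).
move=> z; apply: cvgMl.
case: Sp => [p0|[Ip p0]]; first exact: heat_quotient_cvg_gt0.
apply: cvg_within_filter.
exact: (heat_quotient_cvg_eq0 oI Ip p0 dF (cF' _ Ip)).
Unshelve. all: by end_near. Qed.
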